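(* Let $\tau=1$. For every instance with $n$ agents and $m$ projects, every solution $\mathbf{x}\in[0,1]^m$ such that $\sum_{j\in[m]}x_j=1$ satisfies all agents; that is, for every agent $i\in[n]$ there is a project $j\in[m]$ with $x_j\ge d^i_j$.
   Context: An instance with $n$ agents and $m$ projects consists of demands $d^i_j\in[0,1]$ for $i\in[n]=\{1,\dots,n\}$ and $j\in[m]$, with $\sum_{j=1}^m d^i_j\le 1$ for every agent $i$. A solution is a vector $\mathbf{x}\in[0,1]^m$. Given a threshold $\tau$, agent $i$ is satisfied by $\mathbf{x}$ if the number of projects $j\in[m]$ with $x_j\ge d^i_j$ is at least $\tau$. *)

(* Defs.v *)
From mathcomp Require Import all_boot all_order all_algebra.

Set Implicit Arguments.
Unset Strict Implicit.
Unset Printing Implicit Defensive.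

Import Order.TTheory GRing.Theory Num.Theory.
Local Open Scope ring_scope.

(* Entry [d i j] is the demand of agent [i] for project [j]. *)
Definition is_instance (R : realFieldType) (n m : nat) (d : 'M[R]_(n, m)) : Prop :=
  (forall i j, 0 <= d i j <= 1) /\ (forall i, \sum_(j < m) d i j <= 1).

Definition is_solution (R : realFieldType) (m : nat) (x : 'rV[R]_m) : Prop :=
  forall j, 0 <= x 0 j <= 1.

Definition satisfied (R : realFieldType) (n m : nat) (tau : nat)
    (d : 'M[R]_(n, m)) (x : 'rV[R]_m) (i : 'I_n) : Prop :=
  (tau <= #|[set j : 'I_m | (x 0 j >= d i j)%R]|)%N.

(* Main.v *)
Require Import Defs.
From mathcomp Require Import all_boot all_order all_algebra.

Set Implicit Arguments.
Unset Strict Implicit.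
Unset Printing Implicit Defensive.

Import Order.TTheory GRing.Theory Num.Theory.
Local Open Scope ring_scope.

(** If agent [i] demanded strictly more than [x] offers on every project, summing over the projects
    would push the agent's total demand above the total of [x], which is 1, against the bound in
    [is_instance]. *)

Theorem proposition1 (R : realFieldType) (n m : nat) (d : 'M[R]_(n, m))
    (hd : is_instance d) (x : 'rV[R]_m) (hx : is_solution x)
    (hsum : \sum_(j < m) x 0 j = 1) :
  forall i : 'I_n, satisfied 1 d x i /\ (exists j : 'I_m, x 0 j >= d i j).
Proof.
move=> i.
have [j le_dx] : exists j : 'I_m, x 0 j >= d i j.
  apply/existsP; apply: contraT; rewrite negb_exists => /forallP lt_xd.
  (* The total budget [1] is nonzero, so there is at least one project and the
     strict inequalities survive summation. *)
  have m_gt0 : (0 < m)%N.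
    case: m d x hsum {hd hx lt_xd} => // d x.
    by rewrite big_ord0 => /esym/eqP; rewrite oner_eq0.
  have : \sum_(j < m) x 0 j < \sum_(j < m) d i j.
    apply: ltr_sum => [|j _]; last by rewrite ltNge.
    by apply/hasP; exists (Ordinal m_gt0); rewrite ?mem_index_enum.
  by rewrite hsum ltNge (hd.2 i).
split; last by exists j.
(* At threshold 1, being satisfied means that the set of projects meeting the demand is nonempty,
   and [j] lies in it. *)
by rewrite /satisfied card_gt0; apply/set0Pn; exists j; rewrite inE.
Qed.
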